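(* Let $\mathcal{P}$ be a hereditary property of tournaments. Then either (a) $|\mathcal{P}_n|$ is bounded (as a function of $n$), and there exist $M, N \in \mathbb{N}$ such that $|\mathcal{P}_n| = M$ for every $n \geq N$, or (b) $|\mathcal{P}_n| \geq n-2$ for every $n \in \mathbb{N}$. Moreover, there exists a unique hereditary property of tournaments $\mathcal{P}$ such that $|\mathcal{P}_n| = n-2$ for every $n \in \mathbb{N}$ with $n \geq 4$.
   Context: A tournament is a finite complete graph with an orientation on each edge. $\mathbb{N} = \{1,2,3,\ldots\}$. A hereditary property of tournaments is a collection $\mathcal{P}$ of tournaments that is closed under isomorphism, closed under taking induced subtournaments, and contains arbitrarily large tournaments. $\mathcal{P}_n$ denotes the collection of distinct (i.e., pairwise non-isomorphic) tournaments in $\mathcal{P}$ with exactly $n$ vertices. *)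

(* Defs.v *)
From mathcomp Require Import all_boot boolp.
Set Implicit Arguments.
Unset Strict Implicit.
Unset Printing Implicit Defensive.

Definition is_tournament (V : finType) (e : rel V) : bool :=
  [forall x, ~~ e x x] && [forall x, forall y, (x != y) ==> (e x y (+) e y x)].

(* The empty tournament is allowed; every hereditary property contains it. *)
Record tournament := Tournament {
  vertex :> finType;
  beats : rel vertex;
  beatsP : is_tournament beats
}.

Definition isomorphic (G H : tournament) : Prop :=
  exists2 f : G -> H, bijective f & forall x y, beats (f x) (f y) = beats x y.

Definition induced_beats (G : tournament) (S : {set G}) : rel {x : G | x \in S} :=
  fun x y => beats (val x) (val y).

Lemma induced_beatsP (G : tournament) (S : {set G}) :
  is_tournament (@induced_beats G S).
Proof.
have /andP[/forallP irrG /forallP totG] := beatsP G.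
apply/andP; split; first by apply/forallP => x; apply: irrG.
apply/forallP => x; apply/forallP => y; apply/implyP => xy.
by have /forallP/(_ (val y))/implyP := totG (val x); apply; rewrite val_eqE.
Qed.

Definition induced (G : tournament) (S : {set G}) : tournament :=
  Tournament (induced_beatsP S).

Record hereditary (P : tournament -> Prop) : Prop := Hereditary {
  hereditary_iso : forall G H : tournament, isomorphic G H -> P G -> P H;
  hereditary_induced : forall (G : tournament) (S : {set G}),
    P G -> P (induced S);
  hereditary_large : forall n : nat, exists2 G : tournament, P G & n <= #|G|
}.

Definition labelled_tournament (n : nat) : finType :=
  {a : {ffun 'I_n * 'I_n -> bool} | is_tournament (fun x y => a (x, y))}.

Definition of_labelled n (t : labelled_tournament n) : tournament :=
  Tournament (valP t).

(* The number of isomorphism classes of n-vertex members of P. As P is closed *)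
(* under isomorphism, it is enough to consider members with vertex set 'I_n.  *)
Definition num_unlabelled (P : tournament -> Prop) (n : nat) : nat :=
  #|equivalence_partition
      (fun s t : labelled_tournament n => `[< isomorphic (of_labelled s) (of_labelled t) >])
      [set t : labelled_tournament n | `[< P (of_labelled t) >]]|.

(* Main.v *)
Require Import Defs.
From mathcomp Require Import all_boot boolp zify.

(* A longest chain (transitive subtournament) of a tournament G either        *)
(* exhibits one of four patterns, each a vertex together with a chain of      *)
(* length about 2k: the cyclic triangle with two vertices blown up to         *)
(* k-chains, or a chain with a single reversed arc such that at least k       *)
(* vertices lie on two of the three sides: before, between and after its      *)
(* ends. Otherwise, away from the two ends of the chain, no outside vertex    *)
(* distinguishes two of its members; since a long chain inside the common in- *)
(* or out-neighbourhood would prolong it, Ramsey's theorem for tournaments    *)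
(* bounds the number of remaining vertices. If patterns occur in P for every  *)
(* k, then P contains a family with at least n - 2 members of each order n,   *)
(* and with n - 1 of them unless the pattern is the blown-up triangle. If for *)
(* some k they do not occur, all but boundedly many vertices of each member   *)
(* of P form a chain that is a module; shortening it by one vertex is         *)
(* injective on isomorphism classes, because two such modules intersect and a *)
(* module can be lengthened again at any common vertex. Hence the numbers of  *)
(* classes are eventually nonincreasing, thus constant.                       *)

Set Implicit Arguments.
Unset Strict Implicit.
Unset Printing Implicit Defensive.

(** Everything is measured against one-vertex extensions of transitive tournaments, coded by bit
    words, so that dropping chain vertices becomes taking a subsequence. The structural half is
    [middle_constant] and [exists_chain_module]: without the four patterns of [complex], a
    tournament is a transitive module plus boundedly many vertices. Then [delete_isomorphic] makes
    the deletion of a module vertex injective on classes, so the counts become stationary. The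
    counting half, [flip_words_num] and [cyc_words_num], separates the members cut out of a large
    pattern by isomorphism invariants.

    For uniqueness: the values n - 2 are not eventually constant, so patterns of every size occur. A
    flip pattern would already give three classes of order 4 instead of two, hence P contains all of
    [cyclic_blowup]. That property has exactly n - 2 classes for each n at least 4, and it contains
    every tournament on at most three vertices, so nothing else fits into P. *)

(** * Tournaments, embeddings and isomorphism *)

Lemma beats_irr (G : tournament) : irreflexive (@beats G).
Proof. by move=> x; have /andP[/forallP/(_ x)/negbTE] := beatsP G. Qed.

Lemma beatsN (G : tournament) (x y : G) : x != y -> beats y x = ~~ beats x y.
Proof.
move=> xy; have /andP[_ /forallP/(_ x)/forallP/(_ y)/implyP/(_ xy)] := beatsP G.
by case: (beats x y); case: (beats y x).
Qed.

Lemma beats_asym (G : tournament) (x y : G) : beats x y -> beats y x = false.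
Proof.
by have [-> | xy] := eqVneq x y; [rewrite beats_irr | rewrite (beatsN xy) => ->].
Qed.

Lemma beats_neq (G : tournament) (x y : G) : beats x y -> x != y.
Proof. by apply: contraTneq => ->; rewrite beats_irr. Qed.

Lemma tournamentP (V : finType) (e : rel V) :
  irreflexive e -> (forall x y, x != y -> e x y (+) e y x) -> is_tournament e.
Proof.
move=> irr tot; apply/andP; split; first by apply/forallP => x; rewrite irr.
by apply/forallP => x; apply/forallP => y; apply/implyP; apply: tot.
Qed.

Definition embeds (G H : tournament) : Prop :=
  exists f : G -> H, forall x y, beats (f x) (f y) = beats x y.

Lemma beats_inj (G H : tournament) (f : G -> H) :
  (forall x y, beats (f x) (f y) = beats x y) -> injective f.
Proof.
move=> fP x y fxy; apply/eqP/negPn/negP => xy.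
by have := beatsN xy; rewrite -!fP fxy beats_irr.
Qed.

Lemma isomorphicP (G H : tournament) (f : G -> H) :
  (forall x y, beats (f x) (f y) = beats x y) -> #|H| <= #|G| -> isomorphic G H.
Proof. by move=> fP leHG; exists f => //; apply: inj_card_bij (beats_inj fP) _. Qed.

Lemma embeds_isomorphic (G H : tournament) :
  embeds G H -> #|H| <= #|G| -> isomorphic G H.
Proof. by case=> f; apply: isomorphicP. Qed.

Lemma isomorphic_embeds (G H : tournament) : isomorphic G H -> embeds G H.
Proof. by case=> f _; exists f. Qed.

Lemma isomorphic_refl (G : tournament) : isomorphic G G.
Proof. by exists id => //; exists id. Qed.

Lemma isomorphic_sym (G H : tournament) : isomorphic G H -> isomorphic H G.
Proof.
case=> f [g fK gK] fP; exists g; first by exists f.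
by move=> x y; rewrite -fP !gK.
Qed.

Lemma isomorphic_trans (G H K : tournament) :
  isomorphic G H -> isomorphic H K -> isomorphic G K.
Proof.
case=> f bf fP [g bg gP]; exists (g \o f); first exact: bij_comp.
by move=> x y /=; rewrite gP fP.
Qed.

Lemma embeds_trans (G H K : tournament) : embeds G H -> embeds H K -> embeds G K.
Proof. by case=> f fP [g gP]; exists (g \o f) => x y /=; rewrite gP fP. Qed.

Lemma hereditary_embeds (P : tournament -> Prop) (G H : tournament) :
  hereditary P -> embeds G H -> P H -> P G.
Proof.
move=> hP [f fP] PH; pose S := [set f x | x in G].
apply: (hereditary_iso hP) (hereditary_induced hP S PH).
apply: isomorphic_sym.
have fS x : f x \in S by apply: imset_f.
apply: (@isomorphicP G (induced S) (fun x => exist _ (f x) (fS x))).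
  by move=> x y; rewrite /= /induced_beats /= fP.
by rewrite /= card_sig card_imset //; apply: beats_inj.
Qed.

Lemma isomorphic_labelled (G : tournament) (n : nat) : #|G| = n ->
  exists t : labelled_tournament n, isomorphic G (of_labelled t).
Proof.
move=> <-{n}; pose e := [ffun p : 'I_#|G| * 'I_#|G| => beats (enum_val p.1) (enum_val p.2)].
have eP : is_tournament (fun x y => e (x, y)).
  apply: tournamentP => [x | x y xy]; rewrite !ffunE ?beats_irr //=.
  by rewrite [X in _ (+) X]beatsN ?(inj_eq enum_val_inj) //; case: beats.
exists (exist _ e eP); apply: isomorphic_sym.
apply: (@isomorphicP (of_labelled (exist _ e eP)) G (fun i => enum_val (i : 'I_#|G|))).
  by move=> x y; rewrite /= ffunE.
by rewrite /= card_ord.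
Qed.

(** * Counting isomorphism classes *)

(** Choosing one labelled tournament per block replaces the cardinality of a quotient by a system of
    representatives; later bounds are then injections between index types. *)
Lemma num_unlabelled_reps (P : tournament -> Prop) (n : nat) :
  (forall G H : tournament, isomorphic G H -> P G -> P H) ->
  exists F : 'I_(num_unlabelled P n) -> tournament,
  [/\ forall i, P (F i), forall i, #|F i| = n,
      forall i j, isomorphic (F i) (F j) -> i = j
    & forall G : tournament, P G -> #|G| = n -> exists i, isomorphic G (F i)].
Proof.
move=> isoP; rewrite /num_unlabelled.
set R := fun s t => _; set S := [set t | _]; set D := equivalence_partition R S.
have Requiv : {in S & &, equivalence_rel R}.
  move=> s t u _ _ _; split; first exact/asboolP/isomorphic_refl.
  move=> /asboolP st; apply/asboolP/asboolP; apply: isomorphic_trans => //.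
  exact: isomorphic_sym.
have partD := equivalence_partitionP Requiv.
have /and3P[/eqP covD trivD D0] := partD.
have /choice[t tP] (i : 'I_#|D|) : exists t, t \in enum_val i.
  apply/set0Pn; apply: contraNneq D0 => <-; exact: enum_valP.
have tS i : t i \in S.
  by rewrite -covD; apply/bigcupP; exists (enum_val i) => //; apply: enum_valP.
have tblock i : pblock D (t i) = enum_val i.
  exact: def_pblock trivD (enum_valP i) (tP i).
exists (fun i => of_labelled (t i)); split.
- by move=> i; have := tS i; rewrite inE => /asboolP.
- by move=> i; rewrite /= card_ord.
- move=> i j ij; apply: enum_val_inj; rewrite -!tblock; apply/eqP.
  rewrite eq_pblock ?covD // pblock_equivalence_partition //.
  exact/asboolP.
- move=> G PG /isomorphic_labelled[s Gs].
  have sS : s \in S by rewrite inE; apply/asboolP; apply: isoP PG.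
  have sD : pblock D s \in D by rewrite pblock_mem ?covD.
  exists (enum_rank_in sD (pblock D s)); apply: isomorphic_trans Gs _.
  have := tP (enum_rank_in sD (pblock D s)).
  by rewrite enum_rankK_in // pblock_equivalence_partition // => /asboolP.
Qed.

Lemma leq_num_unlabelled (P : tournament -> Prop) (n : nat) (I : finType)
    (F : I -> tournament) :
  (forall G H : tournament, isomorphic G H -> P G -> P H) ->
  (forall i, P (F i)) -> (forall i, #|F i| = n) ->
  (forall i j, isomorphic (F i) (F j) -> i = j) ->
  #|I| <= num_unlabelled P n.
Proof.
move=> isoP PF cF injF; have [E [_ _ _ covE]] := num_unlabelled_reps n isoP.
have /choice[g gP] i : exists j, isomorphic (F i) (E j) by apply: covE.
rewrite -[leqRHS]card_ord; apply: (@leq_card _ _ g) => i j gij; apply: injF.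
by apply: isomorphic_trans (gP i) _; rewrite gij; apply: isomorphic_sym.
Qed.

Lemma num_unlabelled_leq (P : tournament -> Prop) (n : nat) (I : finType)
    (F : I -> tournament) :
  (forall G H : tournament, isomorphic G H -> P G -> P H) ->
  (forall G : tournament, P G -> #|G| = n -> exists i, isomorphic G (F i)) ->
  num_unlabelled P n <= #|I|.
Proof.
move=> isoP covF; have [E [PE cE injE _]] := num_unlabelled_reps n isoP.
have /choice[g gP] i : exists j, isomorphic (E i) (F j) by apply: covF.
rewrite -[leqLHS]card_ord; apply: (@leq_card _ _ g) => i j gij; apply: injE.
by apply: isomorphic_trans (gP i) _; rewrite gij; apply: isomorphic_sym.
Qed.

(** * Chains with an apex, coded by words *)

Notation chain G := (pairwise (@beats G)).

Lemma chain_uniq (G : tournament) (s : seq G) : chain G s -> uniq s.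
Proof. exact/pairwise_uniq/beats_irr. Qed.

Lemma map_beats_nseq (G : tournament) (x : G) (k : nat) (b : bool) (s : seq G) :
  size s = k -> {in s, forall y, beats x y = b} -> map (beats x) s = nseq k b.
Proof.
move=> <-{k}; elim: s => //= y s IH sb; rewrite sb ?mem_head // IH // => z zs.
by rewrite sb // inE zs orbT.
Qed.

Definition apex_rel (w : bitseq) : rel (option 'I_(size w)) := fun x y =>
  match x, y with
  | Some i, Some j => i < j
  | None, Some j => nth false w j
  | Some i, None => ~~ nth false w i
  | None, None => false
  end.

Lemma apex_relP (w : bitseq) : is_tournament (@apex_rel w).
Proof.
apply: tournamentP => [[i|] | [i|] [j|]] //=; rewrite ?ltnn //.
- by rewrite (inj_eq Some_inj) -val_eqE /=; case: ltngtP.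
- by case: nth.
- by case: nth.
Qed.

(* A transitive tournament [0 -> 1 -> ...] together with one further vertex    *)
(* [None], which beats the [i]-th vertex of the chain iff the [i]-th letter of *)
(* [w] is [true].                                                              *)
Definition apex (w : bitseq) : tournament := Tournament (apex_relP w).

Lemma card_apex (w : bitseq) : #|apex w| = (size w).+1.
Proof. by rewrite /= card_option card_ord. Qed.

Definition has_word (G : tournament) (w : bitseq) : Prop :=
  exists x t, [/\ x \notin t, chain G t & map (beats x) t = w].

Lemma has_word_embeds (G : tournament) (w : bitseq) :
  has_word G w -> embeds (apex w) G.
Proof.
case=> x [t [xt ct <-]]; set w' := map _ t.
have szw : size w' = size t by rewrite size_map.
exists (fun o => if o is Some i then nth x t (i : 'I_(size w')) else x).
have tP (i : 'I_(size w')) : i < size t by rewrite -szw.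
have xti (i : 'I_(size w')) : x != nth x t i.
  by apply: contraNneq xt => ->; rewrite mem_nth.
move=> [i|] [j|] /=; last by rewrite beats_irr.
- case: (ltngtP i j) => [ij | ji | /ord_inj ->].
  + by apply: (pairwiseP x ct) => //; apply: tP.
  + by apply: beats_asym; apply: (pairwiseP x ct) => //; apply: tP.
  + by rewrite beats_irr.
- by rewrite (nth_map x) // (beatsN (xti i)).
- by rewrite (nth_map x).
Qed.

Lemma apex_has_word (w : bitseq) : has_word (apex w) w.
Proof.
exists None, (map Some (enum 'I_(size w))); split.
- by apply/mapP => -[].
- rewrite pairwise_map; have : pairwise ltn (map val (enum 'I_(size w))).
    by rewrite val_enum_ord -sorted_pairwise ?iota_ltn_sorted //; apply: ltn_trans.
  by rewrite pairwise_map.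
- rewrite -map_comp; apply: (@eq_from_nth _ false); rewrite size_map size_enum_ord //.
  by move=> i lti; rewrite (nth_map (Ordinal lti)) ?size_enum_ord //= nth_enum_ord.
Qed.

Lemma has_word_subseq (G : tournament) (w w' : bitseq) :
  subseq w' w -> has_word G w -> has_word G w'.
Proof.
case/subseqP=> m _ -> [x [t [xt ct <-]]]; exists x, (mask m t).
split; last by rewrite map_mask.
- by apply: contraNN xt; apply: mem_mask.
- exact: pairwise_mask.
Qed.

Lemma apex_subseq (w w' : bitseq) : subseq w' w -> embeds (apex w') (apex w).
Proof.
by move=> ww'; apply/has_word_embeds/(has_word_subseq ww')/apex_has_word.
Qed.

Lemma has_word_isomorphic (G : tournament) (w : bitseq) :
  has_word G w -> #|G| = (size w).+1 -> isomorphic G (apex w).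
Proof.
move=> Gw cG; apply: isomorphic_sym; apply: embeds_isomorphic.
  exact: has_word_embeds.
by rewrite cG card_apex.
Qed.

(** With apex x this is the blow-up x -> A -> B -> x of the cyclic triangle, where A and B are
    chains of lengths [a] and [b]. *)
Definition cyc_word (a b : nat) : bitseq := nseq a true ++ nseq b false.

(* The words of the tournaments obtained from a chain by reversing the single  *)
(* arc between the positions [p] and [p + a + 1].                              *)
Definition flip_word (p a q : nat) : bitseq :=
  nseq p false ++ nseq a true ++ false :: nseq q true.

Lemma size_cyc_word a b : size (cyc_word a b) = a + b.
Proof. by rewrite size_cat !size_nseq. Qed.

Lemma size_flip_word p a q : size (flip_word p a q) = p + a + q.+1.
Proof. by rewrite !size_cat /= !size_nseq addnA. Qed.

Lemma subseq_nseq (T : eqType) (x : T) m n : m <= n -> subseq (nseq m x) (nseq n x).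
Proof.
by elim: n m => [|n IH] [|m] //= mn; rewrite eqxx IH.
Qed.

Lemma subseq_cyc_word a b a' b' :
  a <= a' -> b <= b' -> subseq (cyc_word a b) (cyc_word a' b').
Proof. by move=> aa bb; rewrite cat_subseq ?subseq_nseq. Qed.

Lemma subseq_flip_word p a q p' a' q' : p <= p' -> a <= a' -> q <= q' ->
  subseq (flip_word p a q) (flip_word p' a' q').
Proof.
by move=> pp aa qq; rewrite !cat_subseq ?subseq_nseq //= subseq_nseq.
Qed.

Lemma nth_cyc_word a b i : nth false (cyc_word a b) i = (i < a).
Proof.
rewrite nth_cat !nth_nseq size_nseq; case: ltnP => // _.
by case: ifP.
Qed.

Lemma nth_flip_word p a q i : i < size (flip_word p a q) ->
  nth false (flip_word p a q) i = (p <= i) && (i != p + a).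
Proof.
rewrite size_flip_word => lti; rewrite nth_cat nth_nseq size_nseq.
have [ip | pi] := ltnP i p; first by rewrite ?ip; lia.
rewrite nth_cat nth_nseq size_nseq.
have [ipa | pai] := ltnP (i - p) a; first by rewrite ?ipa; lia.
case E: (i - p - a) => [|j] /=; first by lia.
by rewrite nth_nseq; have -> : j < q; lia.
Qed.

(** These are the words in which no [false] precedes a [true]; this is a pairwise condition, so
    subsequences inherit it. *)
Lemma subword_cyc_word (w : bitseq) (k l : nat) :
  subseq w (cyc_word k l) -> exists a b, w = cyc_word a b.
Proof.
move=> /(subseq_pairwise (r := fun x y : bool => y ==> x)).
have -> : pairwise (fun x y : bool => y ==> x) (cyc_word k l).
  rewrite /cyc_word; elim: k => [|k IH].
    by elim: l => //= l ->; rewrite all_nseq orbT.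
  by apply/andP; split=> //; apply/allP => y _; rewrite implybT.
move=> /(_ isT); elim: w => [|[] w IH] /=; first by exists 0, 0.
  by move=> /andP[_ /IH[a [b ->]]]; exists a.+1, b.
move=> /andP[/all_nthP w0 _]; exists 0, (size w).+1.
rewrite /cyc_word /=; congr (_ :: _); apply: (@eq_from_nth _ false).
  by rewrite size_nseq.
by move=> i iw; rewrite nth_nseq iw; have := w0 false i iw; case: nth.
Qed.

(** * Ramsey's theorem, longest chains and the four patterns *)

(** Ramsey's theorem for tournaments: for any x in [X], the larger of its out- and in-neighbourhoods
    in [X] keeps half of the bound; recurse there and put x first or last. *)
Lemma exists_chain (G : tournament) (r : nat) (X : {set G}) : 2 ^ r <= #|X| ->
  exists s : seq G, [/\ size s = r, chain G s & {subset s <= X}].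
Proof.
elim: r X => [|r IH] X leX; first by exists [::].
have /card_gt0P[x xX] : 0 < #|X| by apply: leq_trans leX; rewrite expn_gt0.
pose O := [set y in X | beats x y]; pose I := [set y in X | beats y x].
have cX : #|X| <= 1 + (#|O| + #|I|).
  have : X \subset [set x] :|: (O :|: I).
    apply/subsetP => y yX; rewrite !inE yX /=; have [//|yx] := eqVneq y x.
    by rewrite (beatsN yx); case: beats.
  move/subset_leq_card/leq_trans; apply.
  apply: leq_trans (leq_card_setU _ _) _; rewrite cards1 leq_add2l.
  exact: leq_card_setU.
rewrite expnS in leX; have r0 : 0 < 2 ^ r by rewrite expn_gt0.
have [OI | IO] : 2 ^ r <= #|O| \/ 2 ^ r <= #|I| by lia.
  have [s [<- cs sO]] := IH _ OI; exists (x :: s); split=> //.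
    rewrite /= cs andbT; apply/allP => y /sO.
    by rewrite inE => /andP[].
  by move=> y; rewrite inE => /predU1P[-> // | /sO]; rewrite inE => /andP[].
have [s [<- cs sI]] := IH _ IO; exists (rcons s x); split.
- by rewrite size_rcons.
- rewrite pairwise_rcons cs andbT; apply/allP => y /sI.
  by rewrite inE => /andP[].
- by move=> y; rewrite mem_rcons inE => /predU1P[-> // | /sI]; rewrite inE => /andP[].
Qed.

Lemma exists_longest_chain (G : tournament) :
  exists2 s, chain G s & forall s', chain G s' -> size s' <= size s.
Proof.
pose p n := `[< exists2 s, chain G s & size s = n >].
have p0 : exists n, p n by exists 0; apply/asboolP; exists [::].
have pmax n : p n -> n <= #|G|.
  by move=> /asboolP[s /chain_uniq/card_uniqP <- <-]; apply: max_card.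
case: (ex_maxnP p0 pmax) => n /asboolP[s cs <-] smax; exists s => // s' cs'.
by apply: smax; apply/asboolP; exists s'.
Qed.

Lemma majority (G : tournament) (x : G) (k : nat) (s : seq G) : size s = k + k ->
  exists A b, [/\ subseq A s, size A = k & {in A, forall y, beats x y = b}].
Proof.
move=> szs; have := count_predC (beats x) s; rewrite szs -!size_filter => cs.
have [kc | ck] := leqP k (size (filter (beats x) s)).
  exists (take k (filter (beats x) s)), true; split.
  - exact: subseq_trans (take_subseq _ _) (filter_subseq _ _).
  - exact: size_takel.
  - by move=> y /mem_take; rewrite mem_filter => /andP[].
have kc : k <= size (filter (predC (beats x)) s) by lia.
exists (take k (filter (predC (beats x)) s)), false; split.
- exact: subseq_trans (take_subseq _ _) (filter_subseq _ _).
- exact: size_takel.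
- by move=> y /mem_take; rewrite mem_filter => /andP[/negbTE].
Qed.

(** The second pattern has one vertex between the ends of the reversed arc: with none,
    [flip_word k 0 k] would be transitive. *)
Definition complex (k : nat) (G : tournament) : Prop :=
  [\/ has_word G (cyc_word k k), has_word G (flip_word k 1 k),
      has_word G (flip_word 0 k k) | has_word G (flip_word k k 0)].

(** * Vertices outside a longest chain *)

Section LongestChain.

Variables (G : tournament) (k : nat) (s1 s2 W s4 s5 : seq G) (x : G).
Let s := s1 ++ s2 ++ W ++ s4 ++ s5.
Let mid := s2 ++ W ++ s4.
Hypothesis simpleG : ~ complex k G.
Hypothesis cs : chain G s.
Hypothesis smax : forall s', chain G s' -> size s' <= size s.
Hypotheses (sz1 : size s1 = k + k) (sz2 : size s2 = k).
Hypotheses (sz4 : size s4 = k) (sz5 : size s5 = k + k).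
Hypothesis xs : x \notin s.

Let beatsx y : y \in s -> beats y x = ~~ beats x y.
Proof. by move=> ys; apply: beatsN; apply: contraNneq xs => ->. Qed.

Let subs (t : seq G) : subseq t s -> [/\ chain G t, x \notin t & {subset t <= s}].
Proof.
move=> ts; have sub_ts := mem_subseq ts; split=> //.
- exact: subseq_pairwise ts cs.
- by apply: contraNN xs; apply: sub_ts.
Qed.

Let sE : s = s1 ++ mid ++ s5.
Proof. by rewrite /s /mid -!catA. Qed.

(** Along [mid], [x] first loses and then wins. If it beat [u] and lost to a later [v], its constant
    behaviour on k vertices [A] of [s1] and k vertices [B] of [s5] would leave four cases, each
    showing one pattern. *)
Lemma middle_pattern (u v : G) :
  subseq [:: u; v] mid -> beats x u -> beats x v.
Proof.
move=> uv xu; apply/negPn/negP => /negbTE xv; apply: simpleG.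
have [A [a [As szA Aa]]] := majority x sz1.
have [B [b [Bs szB Bb]]] := majority x sz5.
have AuvB : subseq (A ++ [:: u; v] ++ B) s by rewrite sE !cat_subseq.
have AvB : subseq (A ++ [:: v] ++ B) s.
  apply: subseq_trans AuvB; rewrite cat_subseq ?subseq_refl //.
  exact: (subseq_cons (v :: B) u).
have AB : subseq (A ++ B) s.
  apply: subseq_trans AvB; rewrite cat_subseq ?subseq_refl //.
  exact: subseq_cons.
case: a Aa => Aa; case: b Bb => Bb.
- apply: Or43; exists x, (A ++ [:: v] ++ B); have [c xt _] := subs AvB.
  by split=> //; rewrite map_cat /= xv (map_beats_nseq szA Aa) (map_beats_nseq szB Bb).
- apply: Or41; exists x, (A ++ B); have [c xt _] := subs AB.
  by split=> //; rewrite map_cat (map_beats_nseq szA Aa) (map_beats_nseq szB Bb).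
- apply: Or42; exists x, (A ++ [:: u; v] ++ B); have [c xt _] := subs AuvB.
  by split=> //; rewrite map_cat /= xu xv (map_beats_nseq szA Aa) (map_beats_nseq szB Bb).
(* Here [A] and [B] beat [x], so [x] ends the chain and the apex is [u]: it loses to [A], beats [B]
   and loses to [x]. *)
- apply: Or44; exists u, (A ++ B ++ [:: x]).
  have [c xt ss] := subs AuvB; have [cAB xAB ssAB] := subs AB.
  move: c; rewrite pairwise_cat /= => /and3P[/allrelP Au cA /and3P[/andP[_ /allP uB] _ cB]].
  have uA : {in A, forall y, beats u y = false}.
    by move=> y yA; apply: beats_asym; apply: Au; rewrite ?inE ?eqxx.
  split.
  + rewrite !mem_cat !inE !negb_or eq_sym (beats_neq xu) andbT.
    apply/andP; split; apply/negP => uAB; first have := Au u u uAB.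
      by rewrite inE eqxx beats_irr => /(_ isT).
    by have := uB u uAB; rewrite beats_irr.
  + rewrite catA pairwise_cat cAB /= andbT allrel1r; apply/allP => y yAB.
    by rewrite beatsx ?ssAB //; move: yAB; rewrite mem_cat => /orP[/Aa|/Bb] ->.
  + rewrite !map_cat /= (map_beats_nseq szA uA) (map_beats_nseq szB uB).
    by rewrite beats_asym.
Qed.

(** If [x] distinguished two members of [W], it would lose to all of [s2] and beat all of [s4].
    These k vertices on either side force it to lose to [s1] and beat [s5], since otherwise a
    pattern appears. Then [x] can be inserted at its turning point in [mid], contradicting
    maximality. *)
Lemma middle_constant : all (beats x) W || all (predC (beats x)) W.
Proof.
have [// | /allPn[v vW xv]] := boolP (all (beats x) W).
rewrite orFb; apply/negPn/negP => /allPn[u uW /negPn xu].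
have sub2 y z : y \in W -> z \in s4 -> subseq [:: y; z] mid.
  move=> yW zs; rewrite -[subseq _ _]/(subseq ([::] ++ [:: y] ++ [:: z]) _).
  by rewrite !cat_subseq ?sub0seq ?sub1seq.
have sub1 y z : y \in s2 -> z \in W -> subseq [:: y; z] mid.
  move=> ys zW; rewrite -[subseq _ _]/(subseq ([:: y] ++ [:: z] ++ [::]) _).
  by rewrite !cat_subseq ?sub0seq ?sub1seq.
have x2 : {in s2, forall y, beats x y = false}.
  move=> y ys2; apply/negP => xy; move/negP: xv; apply.
  exact: middle_pattern (sub1 _ _ ys2 vW) xy.
have x4 : {in s4, forall y, beats x y = true}.
  by move=> y ys4; apply: middle_pattern (sub2 _ _ uW ys4) xu.
have s24 : subseq (s2 ++ s4) mid by rewrite cat_subseq ?subseq_refl // suffix_subseq.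
have [midN [midT midE [midN0 midT1]]] : exists N, exists2 T, mid = N ++ T &
    {in N, forall y, beats x y = false} /\ {in T, forall y, beats x y}.
  have := middle_pattern; elim: mid => [|y t IH] tP; first by exists [::], [::].
  have [xy | xy] := boolP (beats x y).
    exists [::], (y :: t) => //; split=> // z; rewrite inE => /predU1P[-> // | zt].
    by apply: tP xy; rewrite /= eqxx sub1seq.
  have [| N [T ->]] := IH.
    by move=> a b ab; apply: tP; apply: subseq_trans (subseq_cons _ _).
  case=> N0 T1; exists (y :: N), T => //; split=> // z.
  by rewrite inE => /predU1P[-> | /N0 //]; apply: negbTE.
have in1 y : y \in s1 -> y \in s by rewrite mem_cat => ->.
have in5 y : y \in s5 -> y \in s by rewrite !mem_cat => ->; rewrite !orbT.
have inmid y : y \in mid -> y \in s by rewrite sE !mem_cat => ->; rewrite !orbT.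
(* Otherwise take the offending [y] as apex: it beats [s2], loses to [x] and beats [s4]. *)
have x1 : {in s1, forall y, beats x y = false}.
  move=> y ys1; apply/negP => xy; apply: simpleG.
  have ys24 : subseq (y :: s2 ++ s4) s.
    by rewrite sE -cat1s cat_subseq ?sub1seq // -[_ ++ s4]cats0 cat_subseq ?sub0seq.
  have [/= /andP[/allP yP c] xt ss] := subs ys24.
  have [y2 y4] : {in s2, forall z, beats y z = true} /\ {in s4, forall z, beats y z = true}.
    by split=> z zs; apply: yP; rewrite mem_cat zs ?orbT.
  apply: Or43; exists y, (s2 ++ [:: x] ++ s4); split.
  + rewrite !mem_cat !inE !negb_or eq_sym (beats_neq xy) /=.
    apply/andP; split; apply/negP => ys; first by have := y2 y ys; rewrite beats_irr.
    by have := y4 y ys; rewrite beats_irr.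
  + move: c; rewrite !pairwise_cat allrel_catr => /and3P[-> -> ->].
    rewrite allrel1r allrel1l /= !andbT; apply/andP; split; apply/allP => z zs.
      by rewrite beatsx ?x2 // ss // inE mem_cat zs orbT.
    by rewrite x4.
  + rewrite !map_cat /= (map_beats_nseq sz2 y2) (map_beats_nseq sz4 y4).
    by rewrite beats_asym.
(* Otherwise [x] as apex loses to [s2], beats [s4] and loses to [y]. *)
have x5 : {in s5, forall y, beats x y}.
  move=> y ys5; apply/negPn/negP => xy; apply: simpleG.
  have ys24 : subseq ((s2 ++ s4) ++ [:: y]) s.
    rewrite sE -[_ ++ [:: y]]cat0s; apply: cat_subseq; first exact: sub0seq.
    by rewrite cat_subseq ?sub1seq.
  have [c xt _] := subs ys24.
  apply: Or44; exists x, ((s2 ++ s4) ++ [:: y]); split=> //.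
  by rewrite -catA !map_cat (map_beats_nseq sz2 x2) (map_beats_nseq sz4 x4) /= (negbTE xy).
suff /smax : chain G (s1 ++ midN ++ x :: midT ++ s5).
  by rewrite sE midE -catA !size_cat /= size_cat !addnS ltnn.
have inN y : y \in midN -> y \in s by move=> yN; rewrite inmid // midE mem_cat yN.
move: cs; rewrite sE midE -catA.
rewrite !(pairwise_cat, pairwise_cons, allrel_catr, allrel_consr, all_cat).
move=> /and5P[/and3P[-> -> ->] -> /andP[-> ->] -> /and3P[-> -> ->]].
have -> : all ((@beats G)^~ x) s1 by apply/allP => y ys; rewrite beatsx ?x1 ?in1.
have -> : all ((@beats G)^~ x) midN by apply/allP => y ys; rewrite beatsx ?midN0 ?inN.
have -> : all (beats x) midT by apply/allP.
by have -> : all (beats x) s5 by apply/allP.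
Qed.

End LongestChain.

(** * Transitive modules and the injectivity of shortening them *)

Definition chain_module (G : tournament) (W : seq G) : Prop :=
  chain G W /\ forall x, x \notin W -> all (beats x) W \/ all ((@beats G)^~ x) W.

Lemma exists_chain_module (G : tournament) (k : nat) : ~ complex k G ->
  exists2 W : seq G, chain_module W & #|G| <= size W + 2 ^ (6 * k + 2).
Proof.
move=> simpleG; have [s cs smax] := exists_longest_chain G.
have [W [cW Wmod leW]] : exists W : seq G, [/\ chain G W,
    forall x, x \notin W -> all (beats x) W \/ all ((@beats G)^~ x) W &
    size s <= size W + 6 * k].
  (* The four blocks cut off use 2k + k + k + 2k = 6k vertices; for a shorter chain the empty module
     will do. *)
  have [szs | szs] := ltnP (size s) (6 * k); first by exists [::]; split=> //=; lia.
  pose s1 := take (k + k) s; pose r1 := drop (k + k) s.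
  pose s2 := take k r1; pose r2 := drop k r1.
  pose W := take (size s - 6 * k) r2; pose r3 := drop (size s - 6 * k) r2.
  pose s4 := take k r3; pose s5 := drop k r3.
  have sE : s = s1 ++ s2 ++ W ++ s4 ++ s5 by rewrite !cat_take_drop.
  have sz1 : size s1 = k + k by rewrite size_takel //; lia.
  have szr1 : size r1 = size s - (k + k) by rewrite size_drop.
  have sz2 : size s2 = k by rewrite size_takel // szr1; lia.
  have szr2 : size r2 = size s - (k + k) - k by rewrite size_drop szr1.
  have szW : size W = size s - 6 * k by rewrite size_takel // szr2; lia.
  have szr3 : size r3 = 3 * k. by rewrite size_drop szr2; lia.
  have sz4 : size s4 = k by rewrite size_takel // szr3; lia.
  have sz5 : size s5 = k + k by rewrite size_drop szr3; lia.
  have : chain G (s1 ++ s2 ++ W ++ s4 ++ s5) by rewrite -sE.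
  rewrite !pairwise_cat !allrel_catr.
  move=> /and3P[/and3P[_ W1 _] _ /and3P[/andP[W2 _] _ /and3P[/andP[W4 W5] cW _]]].
  exists W; split=> //; last by rewrite szW; lia.
  move=> x xW; have [xs | xs] := boolP (x \in s).
    move: xs; rewrite sE !mem_cat (negbTE xW) /= => /or4P[] xs.
    - by left; apply/allP => y yW; apply: (allrelP W1).
    - by left; apply/allP => y yW; apply: (allrelP W2).
    - by right; apply/allP => y yW; apply: (allrelP W4).
    - by right; apply/allP => y yW; apply: (allrelP W5).
  rewrite sE in cs smax xs.
  have /orP[-> | /allP xN] := middle_constant simpleG cs smax sz1 sz2 sz4 sz5 xs.
    by left.
  right; apply/allP => y yW; have xy : x != y by apply: contraNneq xW => ->.
  by rewrite (beatsN xy); apply: xN.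
exists W => //.
pose O := [set x | (x \notin W) && all (beats x) W].
pose I := [set x | (x \notin W) && all ((@beats G)^~ x) W].
have cG : #|G| <= size W + (#|O| + #|I|).
  rewrite -cardsT; have -> : [set: G] = [set x in W] :|: (O :|: I).
    apply/setP => x; rewrite !inE; have [//|xW] := boolP (x \in W).
    by have [-> | ->] := Wmod x xW; rewrite ?orbT.
  apply: leq_trans (leq_card_setU _ _) _; apply: leq_add; last exact: leq_card_setU.
  by rewrite cardsE card_size.
(* Every chain in [X] prolongs [W], so by maximality of [s] it has at most 6k vertices, and
   [exists_chain] bounds [X]. Applied to [O] and [I], this gives 2 * 2 ^ (6 * k + 1). *)
have small (X : {set G}) : (forall t, chain G t -> {subset t <= X} ->
    exists2 t', chain G t' & size t' = size t + size W) -> #|X| < 2 ^ (6 * k).+1.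
  move=> XP; rewrite ltnNge; apply/negP => /exists_chain[t [szt ct tX]].
  have [t' /smax + szt'] := XP t ct tX; lia.
have cO : #|O| < 2 ^ (6 * k).+1.
  apply: small => t ct tO; exists (t ++ W); last by rewrite size_cat.
  rewrite pairwise_cat ct cW !andbT; apply/allrelP => y z /tO.
  by rewrite inE => /andP[_ /allP]; apply.
have cI : #|I| < 2 ^ (6 * k).+1.
  apply: small => t ct tI; exists (W ++ t); last by rewrite size_cat addnC.
  rewrite pairwise_cat ct cW !andbT; apply/allrelP => y z yW /tI.
  by rewrite inE => /andP[_ /allP]; apply.
apply: leq_trans cG _; rewrite leq_add2l addn2 expnS mul2n -addnn.
by apply: leq_add; apply: ltnW.
Qed.

(** The new vertex [None] is a twin of [u] placed just before it. *)
Definition double_rel (G : tournament) (u : G) : rel (option G) := fun x y =>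
  match x, y with
  | Some x, Some y => beats x y
  | None, Some y => (y == u) || beats u y
  | Some x, None => beats x u
  | None, None => false
  end.

Lemma double_relP (G : tournament) (u : G) : is_tournament (double_rel u).
Proof.
apply: tournamentP => [[x|] | [x|] [y|]] //=; rewrite ?beats_irr //.
- by rewrite (inj_eq Some_inj) => /beatsN->; case: beats.
- by have [-> | /beatsN->] := eqVneq x u; rewrite ?beats_irr //=; case: beats.
- by have [-> | /beatsN->] := eqVneq y u; rewrite ?beats_irr //=; case: beats.
Qed.

Definition double (G : tournament) (u : G) : tournament :=
  Tournament (double_relP u).

Lemma card_double (G : tournament) (u : G) : #|double u| = #|G|.+1.
Proof. by rewrite /= card_option. Qed.

Definition delete (G : tournament) (v : G) : tournament := induced (~: [set v]).

Lemma card_delete (G : tournament) (v : G) : #|delete v| = #|G|.-1.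
Proof. by rewrite /= card_sig -[LHS]/#|~: [set v]| cardsC1. Qed.

(** Glue [h] outside [W] to the order-preserving matching of [W] with [W']; the last hypothesis lets
    an outside vertex ignore which member of a chain it meets. *)
Lemma replace_chain_module (G H : tournament) (W : seq G) (W' : seq H) (h : G -> H) :
  chain G W -> chain H W' -> size W = size W' -> #|H| <= #|G| ->
  (forall x, x \notin W -> h x \notin W') ->
  (forall x y, x \notin W -> y \notin W -> beats (h x) (h y) = beats x y) ->
  (forall x y y', x \notin W -> y \in W -> y' \in W' ->
     beats (h x) y' = beats x y) ->
  isomorphic G H.
Proof.
move=> cW cW' szW leHG hW' hout hin.
(* The default [h x] is never reached on [W], as both chains have the same length. *)
pose f x := if x \in W then nth (h x) W' (index x W) else h x.
have fW' x : x \in W -> f x \in W'.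
  by move=> xW; rewrite /f xW mem_nth // -szW index_mem.
apply: (isomorphicP (f := f)) => // x y.
have fxy x' y' : x' \notin W -> y' \in W -> beats (f x') (f y') = beats x' y'.
  by move=> xW yW; rewrite /f (negbTE xW); apply: hin => //; apply: fW'.
have [xW | xW] := boolP (x \in W); have [yW | yW] := boolP (y \in W).
- have lt a b : a \in W -> b \in W -> index a W < index b W ->
      beats a b /\ beats (f a) (f b).
    move=> aW bW ab; split.
      have := pairwiseP a cW (index a W) (index b W).
      by rewrite !inE !index_mem !nth_index //; apply.
    rewrite /f aW bW (set_nth_default (h a)) -?szW ?index_mem //.
    by apply: (pairwiseP (h a) cW'); rewrite ?inE -?szW ?index_mem.
  case: (ltngtP (index x W) (index y W)) => [xy | yx | exy].
  + by have [-> ->] := lt x y xW yW xy.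
  + by have [/beats_asym-> /beats_asym->] := lt y x yW xW yx.
  + by rewrite -(nth_index x yW) -exy nth_index // !beats_irr.
- have yx : y != x by apply: contraNneq yW => ->.
  have fyx : f y != f x.
    by apply: contraTneq (fW' x xW) => <-; rewrite /f (negbTE yW) hW'.
  by rewrite (beatsN fyx) (beatsN yx) fxy.
- exact: fxy.
- by rewrite /f (negbTE xW) (negbTE yW) hout.
Qed.

(** Only the length of a chain module matters, not where it is lengthened: doubling any remaining
    member restores [G]. *)
Lemma delete_double (G : tournament) (v : G) (W : seq G) (u : delete v) :
  chain_module (v :: W) -> val u \in W -> isomorphic G (double u).
Proof.
case=> cW modW uW; case/splitPr: {2}W / uW (erefl W) => L R EW.
pose h x : double u := insub x : option (delete v).
have hE x : x != v -> exists2 x' : delete v, val x' = x & h x = Some x'.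
  move=> xv; have xS : x \in ~: [set v] by rewrite !inE.
  by exists (Sub x xS) => //; rewrite /h insubT.
have hval (x' : delete v) : h (val x') = Some x' by rewrite /h valK.
have hb x y : x != v -> y != v -> beats (h x) (h y) = beats x y.
  by move=> /hE[x' <- ->] /hE[y' <- ->].
have hN x : x != v -> beats (h x) (None : double u) = beats x (val u).
  by move=> /hE[x' <- ->].
have Nh x : x != v -> beats (None : double u) (h x) = (x == val u) || beats (val u) x.
  by move=> /hE[x' <- ->] /=; rewrite val_eqE.
move: cW; rewrite /= => /andP[/allP vW cW].
have Wv x : x \in W -> x != v by move/vW; rewrite eq_sym; apply: beats_neq.
have Lv x : x \in L -> x != v by move=> xL; apply: Wv; rewrite EW mem_cat xL.
have Rv x : x \in R -> x != v by move=> xR; apply: Wv; rewrite EW mem_cat inE xR !orbT.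
(* The twin stands just before [u] in the new chain, whereas [v] headed the old one. *)
apply: (@replace_chain_module G (double u) (v :: W)
   (map h L ++ None :: map h (val u :: R)) h).
- by rewrite /= cW andbT; apply/allP.
- have : chain (double u) (map h W).
    rewrite pairwise_map -(eq_in_pairwise (P := predC1 v) (r := @beats G)) //.
      by move=> x y xv yv; apply/esym/hb.
    by apply/allP => x /Wv.
  rewrite EW map_cat pairwise_cat => /and3P[cLR cL cR].
  rewrite pairwise_cat pairwise_cons allrel_consr cLR cL cR.
  move: cW; rewrite EW pairwise_cat allrel_consr.
  move=> /and3P[/andP[/allP Lu _] _ /andP[/allP uR _]].
  rewrite !andbT.
  apply/andP; split; apply/allP => y.
  + by case/mapP => x xL ->; rewrite hN ?Lv ?Lu.
  + rewrite inE => /predU1P[-> | /mapP[x xR ->]]; last by rewrite Nh ?Rv ?uR ?orbT.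
    by rewrite Nh ?eqxx // Wv // EW mem_cat mem_head orbT.
- by rewrite /= EW !size_cat /= !size_map !addnS.
- by rewrite card_double card_delete prednK //; apply/card_gt0P; exists v.
- move=> x; rewrite inE negb_or => /andP[xv xW].
  have hmap (s : seq G) : {subset s <= W} -> h x \notin map h s.
    move=> sW; apply/mapP => -[y yW]; have [y' yy' ->] := hE y (Wv y (sW y yW)).
    have [x' xx' ->] := hE x xv => -[exy]; case/negP: xW.
    by apply: sW; rewrite -xx' exy yy'.
  rewrite mem_cat negb_or in_cons negb_or !hmap //; first by have [x' _ ->] := hE x xv.
  + by move=> y yR; rewrite EW mem_cat yR orbT.
  + by move=> y yL; rewrite EW mem_cat yL.
- by move=> x y; rewrite !inE !negb_or => /andP[xv _] /andP[yv _]; apply: hb.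
- move=> x y y' xW yW y'W.
  have xv : x != v by apply: contraNneq xW => ->; apply: mem_head.
  have [z zW ->] : exists2 z, z \in v :: W & beats (h x) y' = beats x z.
    move: y'W; rewrite mem_cat inE => /or3P[/mapP[z zL ->] | /eqP-> | /mapP[z zR ->]].
    - by exists z; [rewrite inE EW mem_cat zL /= orbT | rewrite hb // Lv].
    - by exists (val u); [rewrite inE EW mem_cat mem_head !orbT | rewrite hN].
    - have zW : z \in W by rewrite EW mem_cat zR orbT.
      by exists z; [rewrite inE zW orbT | rewrite hb // Wv].
  have [/allP xP | /allP xP] := modW x xW; first by rewrite !xP.
  by rewrite (beats_asym (xP y yW)) (beats_asym (xP z zW)).
Qed.

Lemma isomorphic_double (G H : tournament) (f : G -> H) (u : G) :
  bijective f -> (forall x y, beats (f x) (f y) = beats x y) ->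
  isomorphic (double u) (double (f u)).
Proof.
move=> bf fP; apply: (@isomorphicP (double u) (double (f u)) (omap f)).
  by move=> [x|] [y|] //=; rewrite fP ?(inj_eq (bij_inj bf)).
by rewrite !card_double (bij_eq_card bf).
Qed.

(** Carried into [delete w], the two shortened modules have more members in total than its #|G| - 1
    vertices, so they share one. Doubling that common vertex restores both [G] and [H]. *)
Lemma delete_isomorphic (G H : tournament) (v : G) (w : H) (V : seq G) (W : seq H) :
  chain_module (v :: V) -> chain_module (w :: W) ->
  #|G| <= size V + size W -> isomorphic (delete v) (delete w) -> isomorphic G H.
Proof.
move=> modV modW leG [f bf fP].
pose A := [set f x | x : delete v in [pred x | val x \in V]].
pose B := [set y : delete w | val y \in W].
have cV (K : tournament) (z : K) (U : seq K) :
    chain_module (z :: U) -> #|[set y : delete z | val y \in U]| = size U.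
  case=> /chain_uniq /= /andP[zU uU] _.
  rewrite -(card_imset _ val_inj) -(card_uniqP uU); apply: eq_card => x.
  apply/imsetP/idP => [[y] | xU]; first by rewrite inE => yU ->.
  have xS : x \in ~: [set z] by rewrite !inE; apply: contraNneq zU => <-.
  by exists (Sub x xS); rewrite ?inE.
have cA : #|A| = size V.
  rewrite card_imset; last exact: bij_inj.
  by rewrite -(cV _ _ _ modV); apply: eq_card => x; rewrite !inE.
have cB := cV _ _ _ modW.
have /set0Pn[y] : A :&: B != set0.
  rewrite -card_gt0; have := cardsUI A B; have : #|A :|: B| <= #|delete w| := max_card _.
  rewrite -(bij_eq_card bf) card_delete.
  have : 0 < #|G| by apply/card_gt0P; exists v.
  rewrite cA cB; lia.
rewrite !inE => /andP[/imsetP[u uV ->] fuW].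
apply: isomorphic_trans (delete_double modV uV) _.
apply: isomorphic_trans (isomorphic_double u bf fP) _.
exact/isomorphic_sym/(delete_double modW).
Qed.

Lemma num_unlabelled_step (P : tournament -> Prop) (k n : nat) :
  hereditary P -> (forall G, P G -> ~ complex k G) ->
  2 * 2 ^ (6 * k + 2) + 2 <= n -> num_unlabelled P n.+1 <= num_unlabelled P n.
Proof.
move=> hP simpleP len; set C := 2 ^ _ in len.
have [F [PF cF injF _]] := num_unlabelled_reps n.+1 (hereditary_iso hP).
have /choice[D DP] i : exists D : tournament, exists (v : F i) (V : seq (F i)),
    [/\ D = delete v, chain_module (v :: V) & n <= size V + C].
  have [[|v V] modV] := exists_chain_module (simpleP _ (PF i)); rewrite cF -/C /= => leC.
    by lia.
  by exists (delete v), v, V; split=> //; lia.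
rewrite -[leqLHS]card_ord; apply: (@leq_num_unlabelled P n _ D) (hereditary_iso hP) _ _ _.
- by move=> i; have [v [V [-> _ _]]] := DP i; apply: (hereditary_induced hP).
- by move=> i; have [v [V [-> _ _]]] := DP i; rewrite card_delete cF.
(* Both shortened modules have at least n - C vertices, and 2 * (n - C) is at least n + 1 by the
   choice of the threshold. *)
- move=> i j; have [v [V [-> modV leV]]] := DP i; have [w [W [-> modW leW]]] := DP j.
  by move=> ij; apply/injF/(delete_isomorphic modV modW) => //; rewrite cF; lia.
Qed.

(** Induction on a bound [m] for [f N]: each strict drop lowers the bound. *)
Lemma nonincreasing_stationary (f : nat -> nat) (N : nat) :
  (forall n, N <= n -> f n.+1 <= f n) ->
  exists N', N <= N' /\ forall n, N' <= n -> f n = f N'.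
Proof.
move: {2}(f N) (leqnn (f N)) => m; elim: m N => [|m IH] N fN fdec.
all: have dec n : N <= n -> f n <= f N.
1,3: by move=> /subnK <-; elim: (n - N) => // d; apply: leq_trans;
  rewrite addSn fdec ?leq_addl.
  by exists N; split=> // n /dec; lia.
have [[n Nn fn] | const] := pselect (exists2 n, N <= n & f n < f N).
  have [||N' [nN' NP]] := IH n; [by lia | by move=> j nj; apply: fdec; lia |].
  by exists N'; split=> //; lia.
exists N; split=> // n Nn; apply/eqP; rewrite eqn_leq dec //= leqNgt.
by apply/negP => fn; apply: const; exists n.
Qed.

Lemma num_unlabelled_gt0 (P : tournament -> Prop) (n : nat) :
  hereditary P -> 0 < num_unlabelled P n.
Proof.
move=> hP; have [G PG leG] := hereditary_large hP n.
pose S := [set x in take n (enum G)].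
have cS : #|S| = n.
  by rewrite cardsE (card_uniqP _) ?take_uniq ?enum_uniq // size_takel -?cardE.
rewrite -card_unit.
apply: (@leq_num_unlabelled P n _ (fun=> induced S)) (hereditary_iso hP) _ _ _.
- by move=> _; apply: (hereditary_induced hP).
- by move=> _; rewrite /= card_sig.
- by move=> [] [].
Qed.

(** * Chains with one reversed arc: invariants and count *)

Definition triangle (G : tournament) (x y z : G) : bool :=
  [&& beats x y, beats y z & beats z x].

Definition in_triangle (G : tournament) (x : G) : bool :=
  [exists y, exists z, triangle x y z].

(** An isomorphism invariant whose size recovers [p] (for [d = true]) or [q] (for [d = false]) from
    [flip_word p a q] when [a] is positive. *)
Definition outside (d : bool) (G : tournament) : {set G} :=
  [set w | [forall x, in_triangle x ==> (if d then beats w x else beats x w)]].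

Lemma isomorphic_outside (d : bool) (G H : tournament) :
  isomorphic G H -> #|outside d G| = #|outside d H|.
Proof.
case=> f [g fK gK] fP; rewrite -(card_imset _ (can_inj fK)); apply: eq_card => w.
have triP x : in_triangle (f x) = in_triangle x.
  apply/existsP/existsP => -[y /existsP[z xyz]]; [exists (g y) | exists (f y)];
    apply/existsP; [exists (g z) | exists (f z)]; move: xyz;
    by rewrite /triangle -![beats _ x]fP -![beats x _]fP -?[beats (g _) _]fP ?gK ?fP.
rewrite -[w]gK mem_imset ?inE; last exact: can_inj fK.
apply/forallP/forallP => wP x.
  by have := wP (g x); rewrite -triP gK; case: (d); rewrite -fP !gK.
by have := wP (f x); rewrite triP; case: (d); rewrite !fP.
Qed.

Lemma card_ord_range (m a b : nat) : b <= m -> #|[set i : 'I_m | a <= i < b]| = b - a.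
Proof.
move=> bm; have lt (i : 'I_(b - a)) : a + i < m by have := ltn_ord i; lia.
rewrite -[RHS]card_ord -(@card_imset _ _ (fun i => Ordinal (lt i))).
  apply: eq_card => i; rewrite inE; apply/idP/imsetP => [ai | [j _ ->]] /=.
    have ltj : i - a < b - a by lia.
    by exists (Ordinal ltj) => //; apply: val_inj => /=; lia.
  by have := ltn_ord j; lia.
by move=> i j [] /addnI /val_inj.
Qed.

Lemma card_apex_range (w : bitseq) (a b : nat) (A : {set apex w}) : b <= size w ->
  (forall x : apex w, (x \in A) = if x is Some i then a <= (i : 'I_(size w)) < b else false) ->
  #|A| = b - a.
Proof.
move=> bw AP.
pose S : {set apex w} := [set Some i | i : 'I_(size w) in [pred i : 'I_(size w) | a <= i < b]].
have -> : A = S.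
  apply/setP => -[i|]; rewrite AP; first by rewrite (mem_imset _ _ Some_inj) inE.
  by apply/esym/imsetP => -[].
rewrite -(card_ord_range a bw) (card_imset _ Some_inj).
by apply: eq_card => i; rewrite !inE.
Qed.

Section FlipWord.

Variables p a q : nat.
Let w := flip_word p a q.
Let None' : apex w := None.
Let Some' (i : 'I_(size w)) : apex w := Some i.

Let beatsN (i : 'I_(size w)) : beats None' (Some' i) = (p <= i) && (i != p + a :> nat).
Proof. exact: nth_flip_word. Qed.

Let Nbeats (i : 'I_(size w)) : beats (Some' i) None' = ~~ ((p <= i) && (i != p + a :> nat)).
Proof. by rewrite -beatsN. Qed.

Let beats_lt (i j : 'I_(size w)) : beats (Some' i) (Some' j) = (i < j).
Proof. by []. Qed.

(** Every cyclic triangle uses the reversed arc, from position [p + a] to the apex, and its third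
    vertex lies between them. *)
Lemma in_triangle_flip_word (x : apex w) : 0 < a ->
  in_triangle x = if x is Some i then p <= (i : 'I_(size w)) <= p + a else true.
Proof.
move=> a0; have szw : size w = p + a + q.+1 := size_flip_word p a q.
have ltp : p < size w by lia.
have ltpa : p + a < size w by lia.
pose u := Some' (Ordinal ltp); pose v := Some' (Ordinal ltpa).
case: x => [i|]; last first.
  apply/existsP; exists u; apply/existsP; exists v.
  by rewrite /triangle beatsN Nbeats beats_lt /=; lia.
rewrite -[Some i]/(Some' i); apply/idP/idP => [|pia].
  case/existsP => -[j|] /existsP[[l|]]; rewrite /triangle -?[Some _]/(Some' _) -?[None]/None'
    ?beatsN ?Nbeats ?beats_lt ?beats_irr ?andbF //; lia.
have [ipa | ipa] := eqVneq (i : nat) (p + a).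
  apply/existsP; exists None'; apply/existsP; exists u.
  by rewrite /triangle beatsN Nbeats beats_lt /=; lia.
apply/existsP; exists v; apply/existsP; exists None'.
by rewrite /triangle beatsN Nbeats beats_lt /=; lia.
Qed.

Lemma card_outside_flip_word (d : bool) : 0 < a ->
  #|outside d (apex w)| = if d then p else q.
Proof.
move=> a0; have szw : size w = p + a + q.+1 := size_flip_word p a q.
have ltp : p < size w by lia.
have ltpa : p + a < size w by lia.
pose u := Some' (Ordinal ltp); pose v := Some' (Ordinal ltpa).
pose lo := if d then 0 else (p + a).+1; pose hi := if d then p else size w.
rewrite (@card_apex_range w lo hi); first by rewrite /lo /hi; case: (d); lia.
  by rewrite /hi; case: (d); lia.
(* Comparison with the apex, [u] and [v] already confines [x] to the right range. *)
move=> x; rewrite inE; apply/forallP/idP => [xP | xlh y].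
  have := xP None'; have := xP u; have := xP v; rewrite !in_triangle_flip_word //=.
  rewrite !leqnn leq_addr /=; rewrite /lo /hi; case: x {xP} => [i|].
    by rewrite -[Some i]/(Some' i); case: (d); rewrite ?beats_lt /=; have := ltn_ord i; lia.
  by case: (d).
rewrite in_triangle_flip_word //; apply/implyP.
case: x xlh => [i|] //; rewrite -[Some i]/(Some' i) /lo /hi.
case: y => [j|]; rewrite -?[Some j]/(Some' j) -?[None]/None'; case: (d);
  rewrite ?beats_lt ?beatsN ?Nbeats; lia.
Qed.

End FlipWord.

(** There is no cyclic triangle, so the condition is vacuous and all vertices count; this value
    differs from those of the nontransitive members of the same order. *)
Lemma card_outside_transitive (d : bool) (p q : nat) :
  #|outside d (apex (flip_word p 0 q))| = (p + q).+2.
Proof.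
have := card_apex (flip_word p 0 q); rewrite size_flip_word addn0 addnS => <-.
rewrite -cardsT; apply: eq_card => x; rewrite !inE; apply/forallP => y; apply/implyP.
case/existsP => z /existsP[t]; case: y => [i|]; case: z => [j|]; case: t => [l|];
  rewrite /triangle /= ?nth_flip_word //= ?ltnn ?andbF // addn0; lia.
Qed.

Lemma flip_words_count (P : tournament -> Prop) (n : nat) (F : nat -> bitseq) (d : bool) :
  hereditary P -> 2 <= n -> (forall i, i < n.-1 -> P (apex (F i))) ->
  (forall i, i < n.-1 -> size (F i) = n.-1) ->
  (forall i j, i < n.-1 -> j < n.-1 ->
    #|outside d (apex (F i))| = #|outside d (apex (F j))| -> i = j) ->
  n.-1 <= num_unlabelled P n.
Proof.
move=> hP n2 PF szF injF; rewrite -[leqLHS]card_ord.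
apply: (@leq_num_unlabelled P n _ (fun i : 'I_n.-1 => apex (F i))) (hereditary_iso hP) _ _ _.
- by move=> i; apply: PF.
- by move=> i; rewrite card_apex szF //; lia.
- by move=> i j /(isomorphic_outside d)/injF ij; apply: val_inj; apply: ij.
Qed.

Lemma has_word_apex (P : tournament -> Prop) (G : tournament) (w w' : bitseq) :
  hereditary P -> P G -> has_word G w -> subseq w' w -> P (apex w').
Proof.
move=> hP PG Gw ww'; apply: (hereditary_embeds hP) PG.
exact/has_word_embeds/(has_word_subseq ww').
Qed.

Lemma flip_words_num (P : tournament -> Prop) (G : tournament) (k n : nat) :
  hereditary P -> P G -> 2 <= n <= k ->
  [\/ has_word G (flip_word k 1 k), has_word G (flip_word 0 k k) |
      has_word G (flip_word k k 0)] ->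
  n.-1 <= num_unlabelled P n.
Proof.
move=> hP PG nk [] Gw.
(* There are n - 2 positions for a reversed arc that spans one vertex; the last index is given to
   the transitive tournament. *)
- apply: (flip_words_count (d := true)
    (F := fun i => if i == n - 2 then flip_word 0 0 (n - 2) else flip_word i 1 (n - 3 - i))) => //.
  + by lia.
  + move=> i lti; apply: (has_word_apex hP PG Gw).
    by case: ifP => _; rewrite subseq_flip_word //; lia.
  + by move=> i lti; case: ifP => [/eqP ei | ei]; rewrite size_flip_word; lia.
  + move=> i j lti ltj; case: eqP => ei; case: eqP => ej;
      rewrite ?card_outside_transitive ?card_outside_flip_word //; lia.
- apply: (flip_words_count (d := false) (F := fun i => flip_word 0 i (n - 2 - i))) => //.
  + by lia.
  + move=> i lti; apply: (has_word_apex hP PG Gw).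
    by rewrite subseq_flip_word //; lia.
  + by move=> i lti; rewrite size_flip_word; lia.
  + move=> [|i] [|j] lti ltj; rewrite ?card_outside_transitive ?card_outside_flip_word //; lia.
- apply: (flip_words_count (d := true) (F := fun i => flip_word (n - 2 - i) i 0)) => //.
  + by lia.
  + move=> i lti; apply: (has_word_apex hP PG Gw).
    by rewrite subseq_flip_word //; lia.
  + by move=> i lti; rewrite size_flip_word; lia.
  + move=> [|i] [|j] lti ltj; rewrite ?card_outside_transitive ?card_outside_flip_word //; lia.
Qed.

(** * Blown-up cyclic triangles: invariant, lower bound and exact count *)

(** The greatest such [d] is the invariant: the apex of a blow-up meets every cyclic triangle, and
    when [a] is at least 2 no vertex meeting all of them has a larger score. *)
Definition apex_score (G : tournament) (d : nat) : Prop :=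
  exists x : G, (forall y z t, triangle y z t -> x \in [:: y; z; t]) /\
    #|[set y | beats x y]| = d.

Lemma isomorphic_apex_score (G H : tournament) (d : nat) :
  isomorphic G H -> apex_score G d -> apex_score H d.
Proof.
case=> f [g fK gK] fP [x [xP <-]]; exists (f x); split.
  move=> y z t; rewrite -[y]gK -[z]gK -[t]gK /triangle !fP => /xP.
  by rewrite !inE !(can_eq fK).
rewrite -(card_imset _ (can_inj fK)); apply: eq_card => y.
by rewrite -[y]gK (mem_imset _ _ (can_inj fK)) !inE fP.
Qed.

Lemma cyc_word_apex_score (a b : nat) : apex_score (apex (cyc_word a b)) a.
Proof.
have szw := size_cyc_word a b; exists None; split.
  move=> [i|] [j|] [l|]; rewrite ?inE ?eqxx ?orbT // /triangle /=; lia.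
rewrite (@card_apex_range _ 0 a); first by rewrite subn0.
  by lia.
by move=> [i|]; rewrite inE //= nth_cyc_word.
Qed.

Lemma apex_score_cyc_word (a b d : nat) :
  1 < a -> apex_score (apex (cyc_word a b)) d -> d <= a.
Proof.
move=> a1 [x [xP <-]]; have szw := size_cyc_word a b.
have [b0 | b0] := posnP b.
  apply: leq_trans (_ : #|[set~ x]| <= a).
    by apply/subset_leq_card/subsetP => y; rewrite !inE eq_sym; apply: beats_neq.
  by rewrite cardsC1 card_apex szw b0 addn0.
have lt0 : 0 < size (cyc_word a b) by lia.
have lt1 : 1 < size (cyc_word a b) by lia.
have lta : a < size (cyc_word a b) by lia.
pose v i : apex (cyc_word a b) := Some i.
have tri (i j : 'I_(size (cyc_word a b))) :
    i < a -> a <= j -> triangle (None : apex (cyc_word a b)) (v i) (v j).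
  by rewrite /triangle /= !nth_cyc_word; lia.
case: x xP => [i|] xP; last first.
  rewrite (@card_apex_range _ 0 a) ?subn0 //; first by lia.
  by move=> [j|]; rewrite inE //= nth_cyc_word.
have in3 (j l : 'I_(size (cyc_word a b))) : j < a -> a <= l -> (i == j) || (i == l).
  move=> ja al; have := xP _ _ _ (tri j l ja al).
  by rewrite !inE /= !(inj_eq Some_inj).
(* A chain vertex meeting all triangles cannot lie in A, which has two members; it must then be the
   only member of B, and so it beats just the apex. *)
have ai : i = a :> nat.
  have := in3 (Ordinal lt0) (Ordinal lta); have := in3 (Ordinal lt1) (Ordinal lta).
  by rewrite -!val_eqE /=; lia.
have b1 : b = 1.
  have [ltb | ] := ltnP a.+1 (size (cyc_word a b)); last by lia.
  by have := in3 (Ordinal lt0) (Ordinal ltb); rewrite -!val_eqE /=; lia.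
apply: leq_trans (_ : #|[set (None : apex (cyc_word a b))]| <= a); last by rewrite cards1; lia.
apply/subset_leq_card/subsetP => -[j|]; rewrite !inE //=.
by have := ltn_ord j; lia.
Qed.

Lemma cyc_words_num (P : tournament -> Prop) (n : nat) :
  hereditary P -> (forall a b, a + b < n -> P (apex (cyc_word a b))) ->
  n - 2 <= num_unlabelled P n.
Proof.
move=> hP PW; rewrite -[leqLHS]card_ord.
(* The parameter [a] runs from 2 to n - 1; with [a = 1] the invariant could return [b] instead. *)
pose F (i : 'I_(n - 2)) := apex (cyc_word (i + 2) (n - 3 - i)).
apply: (@leq_num_unlabelled P n _ F) (hereditary_iso hP) _ _ _.
- by move=> i; apply: PW; have := ltn_ord i; lia.
- by move=> i; rewrite card_apex size_cyc_word; have := ltn_ord i; lia.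
- have score i j : isomorphic (F i) (F j) -> i + 2 <= j + 2.
    move/isomorphic_apex_score/(_ (cyc_word_apex_score _ _)).
    by apply: apex_score_cyc_word; lia.
  move=> i j ij; have := score _ _ ij; have := score _ _ (isomorphic_sym ij).
  by move=> ji ij'; apply: val_inj => /=; lia.
Qed.

(* The subtournaments of the blow-ups [x -> A -> B -> x] of the cyclic triangle *)
(* with [A] and [B] transitive.                                                 *)
Definition cyclic_blowup (G : tournament) : Prop :=
  exists k, embeds G (apex (cyc_word k k)).

Lemma cyclic_blowup_cyc_word (a b : nat) : cyclic_blowup (apex (cyc_word a b)).
Proof.
exists (a + b); apply: apex_subseq.
by apply: subseq_cyc_word; rewrite ?leq_addl ?leq_addr.
Qed.

Lemma hereditary_cyclic_blowup : hereditary cyclic_blowup.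
Proof.
split.
- move=> G H /isomorphic_sym/isomorphic_embeds HG [k Gk]; exists k.
  exact: embeds_trans HG Gk.
- move=> G S [k Gk]; exists k; apply: embeds_trans Gk.
  by exists val.
- move=> n; exists (apex (cyc_word n n)); first exact: cyclic_blowup_cyc_word.
  by rewrite card_apex size_cyc_word; lia.
Qed.

Lemma chain_has_word (G : tournament) (t : seq G) :
  chain G t -> 0 < size t -> has_word G (nseq (size t).-1 true).
Proof.
case: t => // x t /[dup] /chain_uniq /= /andP[xt _] /andP[/allP xP ct] _.
by exists x, t; split=> //; apply: map_beats_nseq.
Qed.

(** The cases are whether the copy of [G] uses the apex [o]; [t] lists the preimages of the other
    vertices in chain order. *)
Lemma embeds_apexP (G : tournament) (w : bitseq) : embeds G (apex w) ->
  (exists2 w', subseq w' w & has_word G w' /\ #|G| = (size w').+1) \/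
  (exists2 t, chain G t & size t = #|G|).
Proof.
case=> f fP; have finj := beats_inj fP.
have [o [s [os cs sw]]] := apex_has_word w.
have sub_s y : f y != o -> f y \in s.
  have us := chain_uniq cs; have : size s = #|apex w|.-1.
    by rewrite card_apex /= -(size_map (beats o)) sw.
  rewrite -(cardsC1 o) -(card_uniqP us) => sE fyo.
  have /subset_cardP/(_ _)/(_ (f y)) : #|s| = #|[set~ o]| by [].
  rewrite !inE => -> //; apply/subsetP => z zs; rewrite !inE.
  by apply: contraNneq os => <-.
have [t ft] : exists t, map f t = filter [in codom f] s.
  have : all [in codom f] (filter [in codom f] s) by apply: filter_all.
  elim: (filter _ s) => [|y r IH] /=; first by exists [::].
  by case/andP => /codomP[x ->] /IH[t <-]; exists (x :: t).
have ct : chain G t.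
  have : chain (apex w) (map f t) by rewrite ft pairwise_filter.
  by rewrite pairwise_map; apply: sub_pairwise => x y; rewrite -fP.
have memt y : f y != o -> y \in t.
  by move=> /sub_s fys; rewrite -(mem_map finj) ft mem_filter fys codom_f.
have [/codomP[x ox] | oN] := boolP (o \in codom f).
  left; have xt : x \notin t.
    by rewrite -(mem_map finj) ft mem_filter -ox (negbTE os) andbF.
  exists (map (beats x) t).
    rewrite -(eq_map (fP x)) (map_comp (beats (f x)) f) ft -ox.
    apply: (@subseq_trans _ (map (beats o) s)); last by rewrite sw.
    exact/map_subseq/filter_subseq.
  split; first by exists x, t.
  rewrite size_map -[RHS]/(size (x :: t)) -(card_uniqP _) /= ?xt ?chain_uniq //.
  apply: eq_card => y; rewrite !inE; have [//|yx /=] := eqVneq y x.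
  by apply/esym/memt; rewrite ox (inj_eq finj).
right; exists t => //; rewrite -(card_uniqP (chain_uniq ct)).
apply: eq_card => y; rewrite !inE; apply: memt.
by apply: contraNneq oN => <-; apply: codom_f.
Qed.

(* Take the first vertex of the chain as the new apex. *)
Lemma has_word_rotate (G : tournament) (c : bool) (b : nat) :
  has_word G (c :: nseq b false) -> has_word G (nseq b true ++ [:: ~~ c]).
Proof.
case=> x [[|y t] [// xyt]] /= /andP[/allP yP ct] [xy xt].
move: xyt; rewrite inE negb_or => /andP[xNy xNt].
have szt : size t = b by rewrite -(size_map (beats x)) xt size_nseq.
exists y, (t ++ [:: x]); split.
- rewrite mem_cat inE eq_sym (negbTE xNy) orbF; apply/negP => /yP.
  by rewrite beats_irr.
- rewrite pairwise_cat ct allrel1r /= andbT; apply/allP => z zt.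
  have xz : x != z by apply: contraNneq xNt => ->.
  rewrite (beatsN xz); have : beats x z \in map (beats x) t by apply: map_f.
  by rewrite xt mem_nseq => /andP[_ /eqP->].
- by rewrite map_cat (map_beats_nseq szt yP) /= (beatsN xNy) xy.
Qed.

(** Rotation turns [a = 0] into a transitive word of [true] letters and [a = 1] into [b = 1]; order
    at least 4 makes the new first parameter at least 2. *)
Lemma cyclic_blowup_normal_form (G : tournament) : cyclic_blowup G -> 4 <= #|G| ->
  exists a b, [/\ 2 <= a, a + b = #|G|.-1 & has_word G (cyc_word a b)].
Proof.
case=> k /embeds_apexP[] => [[w /subword_cyc_word[a [b ->]] [Gw cG]] | [t ct szt]] leG.
  rewrite size_cyc_word in cG; case: a Gw cG => [|[|a]] Gw cG.
  - case: b Gw cG => [|b] Gw cG; first by rewrite cG in leG.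
    exists b.+1, 0; split; [by lia | by rewrite cG; lia |].
    have := has_word_rotate (c := false) Gw.
    by rewrite /cyc_word cats0 cats1 -[b.+1]addn1 nseqD cats1.
  - exists b, 1; split; [by lia | by rewrite cG; lia |].
    exact: (has_word_rotate (c := true) Gw).
  - by exists a.+2, b; split=> //; rewrite cG.
exists #|G|.-1, 0; split; [by lia | by rewrite addn0 |].
by rewrite /cyc_word cats0 -szt; apply: chain_has_word => //; lia.
Qed.

Lemma num_cyclic_blowup (n : nat) : 4 <= n -> num_unlabelled cyclic_blowup n = n - 2.
Proof.
move=> n4; have hC := hereditary_cyclic_blowup; apply/eqP; rewrite eqn_leq.
apply/andP; split; last by apply: cyc_words_num => // a b _; apply: cyclic_blowup_cyc_word.
rewrite -[leqRHS]card_ord.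
apply: (@num_unlabelled_leq _ n _
  (fun i : 'I_(n - 2) => apex (cyc_word (i + 2) (n - 3 - i)))) (hereditary_iso hC) _.
move=> G GC cG; have [|a [b [a2 ab Gab]]] := cyclic_blowup_normal_form GC; first by rewrite cG.
have lta : a - 2 < n - 2 by lia.
exists (Ordinal lta) => /=; have -> : n - 3 - (a - 2) = b by lia.
by rewrite subnK //; apply: has_word_isomorphic => //; rewrite size_cyc_word ab; lia.
Qed.

Lemma has_word_cyclic_blowup (G : tournament) (w : bitseq) : has_word G w ->
  #|G| = (size w).+1 -> subseq w (cyc_word 2 2) -> cyclic_blowup G.
Proof.
move=> Gw cG w2; exists 2; apply: embeds_trans (apex_subseq w2).
exact/isomorphic_embeds/has_word_isomorphic.
Qed.

(** Needed for uniqueness, since the counts say nothing about orders below 4. *)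
Lemma small_cyclic_blowup (G : tournament) : #|G| <= 3 -> cyclic_blowup G.
Proof.
rewrite cardE; have := enum_uniq G; have := mem_enum G; have := cardE G.
case: (enum G) => [|x [|y [|z []]]] //= cG memG uG _.
- by exists 0, (fun=> None) => x; have := memG x.
- apply: (@has_word_cyclic_blowup G [::]) => //.
  by exists x, [::].
- apply: (@has_word_cyclic_blowup G [:: beats x y]); [|by [] | by case: beats].
  by exists x, [:: y]; split=> //; case/andP: uG.
have tri (u v w : G) : uniq [:: u; v; w] -> beats v w -> cyclic_blowup G.
  rewrite /= !inE negb_or => /and3P[/andP[uv uw] _ _] vw.
  (* Only the word [false, true] is not a subsequence of [cyc_word 2 2]; then v -> u -> w is
     transitive and is read from [v] instead. *)
  have [/andP[uv' uw'] | ok] := boolP (~~ beats u v && beats u w); last first.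
    apply: (@has_word_cyclic_blowup G [:: beats u v; beats u w]) => //.
      by exists u, [:: v; w]; split; rewrite /= ?inE ?negb_or ?uv ?uw ?vw.
    by move: ok; do 2!case: beats.
  apply: (@has_word_cyclic_blowup G [:: true; true]) => //.
  exists v, [:: u; w]; split; rewrite /= ?inE ?negb_or ?uw' ?vw ?(beatsN uv) ?uv' //.
  by rewrite eq_sym uv (beats_neq vw).
have [yz | yz] := boolP (beats y z); first exact: tri uG yz.
have yNz : y != z by move: uG; rewrite /= !inE => /and3P[].
apply: (tri x z y); last by rewrite (beatsN yNz).
move: uG; rewrite /= !inE !negb_or => /and3P[/andP[-> ->] _ _].
by rewrite eq_sym yNz.
Qed.

(** * The dichotomy and uniqueness *)

Lemma simple_stationary (P : tournament -> Prop) (k : nat) :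
  hereditary P -> (forall G, P G -> ~ complex k G) ->
  exists M N : nat, [/\ 0 < M, 0 < N & forall n, N <= n -> num_unlabelled P n = M].
Proof.
move=> hP simpleP; pose N := 2 * 2 ^ (6 * k + 2) + 2.
have [N' [NN' N'P]] := nonincreasing_stationary
  (fun n (leNn : N <= n) => num_unlabelled_step hP simpleP leNn).
exists (num_unlabelled P N'), N'; split=> //; first exact: num_unlabelled_gt0.
by rewrite /N in NN'; lia.
Qed.

Lemma complex_num (P : tournament -> Prop) (n : nat) :
  hereditary P -> (exists2 G, P G & complex n G) -> n - 2 <= num_unlabelled P n.
Proof.
move=> hP [G PG Gn]; have [n2 | n2] := leqP 2 n; last by lia.
have flip := flip_words_num hP PG (n := n) (k := n).
case: Gn => Gn; last 3 first.
- by apply: leq_trans (flip _ _); [lia | rewrite n2 /= | constructor 1].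
- by apply: leq_trans (flip _ _); [lia | rewrite n2 /= | constructor 2].
- by apply: leq_trans (flip _ _); [lia | rewrite n2 /= | constructor 3].
apply: cyc_words_num => // a b ab; apply: (has_word_apex hP PG Gn).
by apply: subseq_cyc_word; lia.
Qed.

Lemma cyclic_blowup_unique (P : tournament -> Prop) :
  hereditary P -> (forall n, 4 <= n -> num_unlabelled P n = n - 2) ->
  cyclic_blowup = P.
Proof.
move=> hP numP; have hC := hereditary_cyclic_blowup.
have Pcyc k : P (apex (cyc_word (k + 4) (k + 4))).
  have [[G PG Gk] | simpleP] := pselect (exists2 G, P G & complex (k + 4) G); last first.
    have [|M [N [_ _ NM]]] := @simple_stationary P (k + 4) hP.
      by move=> G PG Gk; apply: simpleP; exists G.
    have := NM (N + 4); have := NM (N + 5).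
    by rewrite !numP; lia.
  (* A flip pattern would give at least 3 classes of order 4, against 4 - 2 = 2. *)
  have flip := flip_words_num hP PG (n := 4) (k := k + 4); rewrite numP // in flip.
  case: Gk => Gk; first exact: has_word_apex hP PG Gk (subseq_refl _).
  - by have := flip _ (Or31 _ _ Gk); rewrite leq_addl => /(_ isT).
  - by have := flip _ (Or32 _ _ Gk); rewrite leq_addl => /(_ isT).
  - by have := flip _ (Or33 _ _ Gk); rewrite leq_addl => /(_ isT).
have CP G : cyclic_blowup G -> P G.
  case=> k Gk; apply: hereditary_embeds hP _ (Pcyc k); apply: embeds_trans Gk _.
  by apply: apex_subseq; apply: subseq_cyc_word; lia.
apply: funext => G; apply: propext; split; first exact: CP.
have [G3 _ | G4] := leqP #|G| 3; first exact: small_cyclic_blowup.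
move=> PG; apply: contrapT => NCG.
have [F [CF cF injF _]] := num_unlabelled_reps #|G| (hereditary_iso hC).
(* Adding [G] to the n - 2 representatives of [cyclic_blowup] would give n - 1 classes in [P]. *)
pose F' o := if o is Some i then F i else G.
have NisoG i : ~ isomorphic (F i) G by move=> FG; apply/NCG/(hereditary_iso hC FG).
suff : #|{: option 'I_(num_unlabelled cyclic_blowup #|G|)}| <= num_unlabelled P #|G|.
  by rewrite card_option card_ord num_cyclic_blowup // numP // ltnn.
apply: (@leq_num_unlabelled _ _ _ F') (hereditary_iso hP) _ _ _.
- by case=> [i|] //=; apply: CP.
- by case=> [i|] /=.
- case=> [i|] [j|] //=; first by move/injF->.
  + by move/NisoG.
  + by move/isomorphic_sym/NisoG.
Qed.

Theorem theorem3 :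
  (forall P : tournament -> Prop, hereditary P ->
     ((exists C : nat, forall n : nat, 0 < n -> num_unlabelled P n <= C) /\
      (exists M N : nat, [/\ 0 < M, 0 < N &
         forall n : nat, N <= n -> num_unlabelled P n = M]))
     \/ (forall n : nat, 0 < n -> n - 2 <= num_unlabelled P n))
  /\
  (exists! P : tournament -> Prop,
     hereditary P /\ forall n : nat, 4 <= n -> num_unlabelled P n = n - 2).
Proof.
split=> [P hP|].
  have [[k simpleP] | complexP] := pselect (exists k, forall G, P G -> ~ complex k G).
    left; have [M [N [M0 N0 NM]]] := simple_stationary hP simpleP.
    split; last by exists M, N.
    (* The sum covers the finitely many orders before the counts become constant. *)
    exists (M + \sum_(i < N) num_unlabelled P i) => n _.
    have [ltnN | /NM-> ] := ltnP n N; last exact: leq_addr.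
    by rewrite (bigD1 (Ordinal ltnN)) //= addnCA leq_addr.
  right=> n _; apply: complex_num => //; apply: contrapT => nG; apply: complexP.
  by exists n => G PG Gn; apply: nG; exists G.
exists cyclic_blowup; split.
  by split; [exact: hereditary_cyclic_blowup | exact: num_cyclic_blowup].
by move=> P [hP numP]; apply: cyclic_blowup_unique.
Qed.
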